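(* Let $(X,\circ)$ be a group, $Y\leq X$ a subgroup, and $\eta^{z_{ij}}:X\to\mathrm{Sym}(X)$ a $p$-affine structure. Define, for all $a,b\in X$ and $z_i,z_j\in Y$, the binary operation $a+_{ij}b:=a\circ\eta_a^{z_{ij}}(b)$ on $X$. Then the maps defined by $$\sigma_a^{z_{ij}}(b):=(\eta_a^{z_{ij}})^{-1}(b)=a\circ\big(a^{-1}+_{i\bar j}b\big)\quad\text{and}\quad\tau_b^{z_{ij}}(a):=\sigma_a^{z_{ij}}(b)^{-1}\circ a\circ b,$$ for all $a,b\in X$ and $z_i,z_j\in Y$, determine a solution $R^{z_{ij}}(b,a)=\big(\sigma_a^{z_{ij}}(b),\tau_b^{z_{ij}}(a)\big)$ on $X$.
   Context: Notation: $0$ is the identity of the group $(X,\circ)$, $a^{-1}$ the inverse in $(X,\circ)$, $z_0:=0$ and $z_{\bar i}:=z_i^{-1}$. A superscript $z_{ij}$ or subscript $ij$ denotes dependence on the ordered pair $(z_i,z_j)\in Y\times Y$; $z_{i,jk}$ denotes dependence on $(z_i,z_j\circ z_k)$, $z_{ij,k}$ dependence on $(z_i\circ z_j,z_k)$; $i\bar j$ means dependence on $(z_i,z_j^{-1})$; a subscript $0$ stands for $z_0=0$. A family $\eta^{z_{ij}}:X\to\mathrm{Sym}(X)$, $a\mapsto\eta_a^{z_{ij}}$ ($z_i,z_j\in Y$), is a $p$-affine structure on $(X,\circ)$ if for all $a,b,c\in X$, $z_i,z_j,z_k\in Y$: $\eta^{z_{i,jk}}_{a\circ b}=\eta_b^{z_{ij}}\eta_a^{z_{ik}}=\eta^{z_{i,kj}}_{a\circ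 b}$; $\ \eta_a^{z_{0j}}(0)=0$; $\ \eta_a^{z_{ij,k}}=\eta_a^{z_{ji,k}}$; and $$\eta_a^{z_{kj,i}}\big(b\circ\eta_b^{z_{kj}}(c)\big)=\eta_a^{z_{ji}}(b)\circ\eta^{z_{ki}}_{\eta_a^{z_{ji}}(b)}\eta_a^{z_{kj}}(c).$$ $R^{z_{ij}}$ is a solution if it satisfies the parametric Yang-Baxter equation $R_{12}^{z_{12}}R_{13}^{z_{13}}R_{23}^{z_{23}}=R_{23}^{z_{23}}R_{13}^{z_{13}}R_{12}^{z_{12}}$ on $X^3$ for all $z_1,z_2,z_3\in Y$, where $R_{mn}$ acts as $R$ on the $m$-th and $n$-th components. *)

(* Defs.v *)
From HB Require Import structures.
From mathcomp Require Import all_boot.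
From mathcomp Require Import boolp classical_sets functions.

Set Implicit Arguments.
Unset Strict Implicit.
Unset Printing Implicit Defensive.

Local Open Scope classical_set_scope.
Local Open Scope group_scope.

(* [Sym X] packs each permutation with its inverse; every bijective function
   carries such a structure by [PbijTT]. *)
Notation Sym X := {splitbij [set: X] >-> [set: X]}.

(* The group (X, o, 0) is written multiplicatively: o is [*], 0 is [1] and
   z_(bar i) is [zi^-1]. The subgroup Y is given as the group of its elements,
   [Y : subGroupType P], where [P] is the underlying subset of X. *)

Section PAffine.
Variables (X : groupType) (P : pred X) (Y : subGroupType P).
Variable eta : Y -> Y -> X -> Sym X.

Definition p_affine : Prop :=
  [/\ forall (zi zj zk : Y) (a b x : X),
        eta zi (zj * zk) (a * b) x = eta zi zj b (eta zi zk a x)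
        /\ eta zi (zk * zj) (a * b) x = eta zi zj b (eta zi zk a x),
      forall (zj : Y) (a : X), eta 1 zj a 1 = 1,
      forall (zi zj zk : Y) (a x : X),
        eta (zi * zj) zk a x = eta (zj * zi) zk a x
    & forall (zi zj zk : Y) (a b c : X),
        eta (zk * zj) zi a (b * eta zk zj b c) =
        eta zj zi a b * eta zk zi (eta zj zi a b) (eta zk zj a c)].

Definition p_add (zi zj : Y) (a b : X) : X := a * eta zi zj a b.

Definition sigma (zi zj : Y) (a b : X) : X := ((eta zi zj a)^-1)%FUN b.

Definition tau (zi zj : Y) (b a : X) : X := (sigma zi zj a b)^-1 * a * b.

Definition Rmap (zi zj : Y) (ba : X * X) : X * X :=
  let: (b, a) := ba in (sigma zi zj a b, tau zi zj b a).

End PAffine.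

Section ParametricYangBaxter.
Variables (X Y : Type).

Definition act12 (f : X * X -> X * X) (t : X * X * X) : X * X * X :=
  let: (x, y, z) := t in let: (x', y') := f (x, y) in (x', y', z).

Definition act13 (f : X * X -> X * X) (t : X * X * X) : X * X * X :=
  let: (x, y, z) := t in let: (x', z') := f (x, z) in (x', y, z').

Definition act23 (f : X * X -> X * X) (t : X * X * X) : X * X * X :=
  let: (x, y, z) := t in let: (y', z') := f (y, z) in (x, y', z').

Definition is_solution (R : Y -> Y -> X * X -> X * X) : Prop :=
  forall z1 z2 z3 : Y,
    act12 (R z1 z2) \o act13 (R z1 z3) \o act23 (R z2 z3)
    =1 act23 (R z2 z3) \o act13 (R z1 z3) \o act12 (R z1 z2).

End ParametricYangBaxter.

(* Main.v *)
Require Import Defs.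
From HB Require Import structures.
From mathcomp Require Import all_boot.
From mathcomp Require Import boolp classical_sets functions.

Local Open Scope classical_set_scope.
Local Open Scope group_scope.

(** Each sigma is a value of eta at inverse arguments, so sigma inherits from
    eta a multiplicativity law, a symmetry of its parameters, and the
    distributivity over the operations [p_add]. Since [R (b, a)] has entries
    with product [a * b], both sides of the Yang-Baxter equation send
    [(x, y, z)] to triples with product [z * y * x], and it suffices to compare
    the first two entries. The first ones agree by multiplicativity. The
    products of the first two are the two sides of
    [sigma_z^(12,3) (y * x) = sigma_z^(21,3) (x1 * y1)] with
    [x1 = sigma_y^(12) x] and [x1 * y1 = y * x], each expanded by
    distributivity. *)

Section Sigma.
Variables (X : groupType) (P : pred X) (Y : subGroupType P).
Variable eta : Y -> Y -> X -> Sym X.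
Hypothesis eta_affine : p_affine eta.

Lemma etaK (i j : Y) (a : X) : cancel (eta i j a) (sigma eta i j a).
Proof. by move=> x; rewrite /sigma funK ?inE. Qed.

Lemma sigmaK (i j : Y) (a : X) : cancel (sigma eta i j a) (eta i j a).
Proof. by move=> x; rewrite /sigma invK ?inE. Qed.

(** By multiplicativity [eta i 1 1] is idempotent, and it is injective. *)
Lemma eta11 (i : Y) (x : X) : eta i 1 1 x = x.
Proof.
case: eta_affine => etaM _ _ _.
apply: (can_inj (etaK i 1 1)).
by have [<- _] := etaM i 1 1 1 1 x; rewrite !mul1g.
Qed.

Lemma sigma_eta (i j : Y) (a b : X) :
  sigma eta i j a b = eta i j^-1 a^-1 b.
Proof.
case: eta_affine => etaM _ _ _.
have [etaVK _] := etaM i j^-1 j a a^-1 (sigma eta i j a b).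
by move: etaVK; rewrite sigmaK mulVg mulgV eta11.
Qed.

Lemma sigmaM (i j k : Y) (a b x : X) :
  sigma eta i (j * k) (a * b) x = sigma eta i j a (sigma eta i k b x).
Proof.
case: eta_affine => etaM _ _ _.
rewrite !sigma_eta !invgM.
by have [_ ->] := etaM i j^-1 k^-1 b^-1 a^-1 x.
Qed.

Lemma sigmaC (i j k : Y) (a x : X) :
  sigma eta i (j * k) a x = sigma eta i (k * j) a x.
Proof.
case: eta_affine => etaM _ _ _.
rewrite !sigma_eta !invgM -[a^-1]mulg1.
by have [-> ->] := etaM i k^-1 j^-1 a^-1 1 x.
Qed.

Lemma sigma_symm (i j k : Y) (a x : X) :
  sigma eta (i * j) k a x = sigma eta (j * i) k a x.
Proof. by case: eta_affine => _ _ etaC _; rewrite !sigma_eta etaC. Qed.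

Lemma sigma_p_add (i j k : Y) (a b c : X) :
  sigma eta (k * j) i a (p_add eta k j b c) =
  p_add eta k j (sigma eta j i a b) (sigma eta k i a c).
Proof.
case: eta_affine => etaM _ _ etaD.
rewrite /p_add !sigma_eta etaD.
(* The two families in [etaD] carry exchanged parameters, [eta^(ki) eta^(kj)];
   the symmetric form of [etaM] swaps them. *)
have [<- _] := etaM k i^-1 j a^-1 (eta j i^-1 a^-1 b) c.
by have [_ ->] := etaM k j i^-1 a^-1 (eta j i^-1 a^-1 b) c.
Qed.

Lemma sigma_tau (i j : Y) (a b : X) :
  sigma eta i j a b * tau eta i j b a = a * b.
Proof. by rewrite /tau -mulgA mulVKg. Qed.

(** Both sides are [sigma] at [z * y], with second parameter [j * k] or [k * j]. *)
Lemma sigma_comp (i j k : Y) (x y z : X) :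
  sigma eta i j (sigma eta j k z y)
    (sigma eta i k (tau eta j k y z) x) =
  sigma eta i k z (sigma eta i j y x).
Proof. by rewrite -!sigmaM sigma_tau sigmaC. Qed.

Lemma sigma_mul (i j k : Y) (x y z : X) :
  sigma eta (i * j) k z (y * x) =
  sigma eta j k z y * sigma eta i k (tau eta j k y z) x.
Proof.
(* Writing [x] as [eta i j y (sigma eta i j y x)] turns [y * x] into a [p_add]. *)
rewrite -[x in y * x](sigmaK i j y) sigma_p_add /p_add -sigma_comp.
by rewrite sigmaK.
Qed.

Lemma sigma_mul_tau (i j k : Y) (x y z : X) :
  let x1 := sigma eta i j y x in
  sigma eta i k z x1 * sigma eta j k (tau eta i k x1 z) (tau eta i j x y) =
  sigma eta j k z y * sigma eta i k (tau eta j k y z) x.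
Proof.
by move=> x1; rewrite -sigma_mul sigma_symm sigma_tau sigma_mul.
Qed.

End Sigma.

Theorem theorem4p16 (X : groupType) (P : pred X) (Y : subGroupType P)
    (eta : Y -> Y -> X -> Sym X) (eta_affine : p_affine eta) :
  (forall (zi zj : Y) (a b : X),
     sigma eta zi zj a b = a * p_add eta zi zj^-1 a^-1 b)
  /\ is_solution (Rmap eta).
Proof.
split=> [i j a b|i j k [[x y] z]]; first by rewrite sigma_eta // mulVKg.
rewrite /= sigma_comp //; set x1 := sigma eta i j y x.
set y' := sigma eta j k z y; set z' := tau eta j k y z.
set x' := sigma eta i k z' x.
have tau_y' : tau eta i j x' y' =
    sigma eta j k (tau eta i k x1 z) (tau eta i j x y).
  rewrite /tau sigma_comp // -/x1 -mulgA.
  by rewrite -sigma_mul_tau // mulKg.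
rewrite tau_y'; congr (_, _, _).
(* The third entry is what remains of the common product [z * y * x]. *)
apply: (mulgI (sigma eta j k (tau eta i k x1 z) (tau eta i j x y))).
apply: (mulgI (sigma eta i k z x1)).
rewrite sigma_tau [RHS]mulgA sigma_tau -mulgA sigma_tau mulgA sigma_mul_tau //.
by rewrite -mulgA sigma_tau mulgA sigma_tau mulgA.
Qed.
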